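(* Let $\gamma \geq 0$ be an integer. For all words $x$ and $y$ of $\mathsf{Dias}_\gamma$ of arities at least $2$, and all positions $i$ of $x$, the partial composition of $\mathsf{Dias}_\gamma$ over the $\mathsf{K}$-basis satisfies $$\mathsf{K}^{(\gamma)}_x \circ_i \mathsf{K}^{(\gamma)}_y = \begin{cases} \mathsf{K}^{(\gamma)}_{x \circ_i y} & \text{if } \min(y) > x_i, \\ \sum_{a \in [x_i, \gamma]} \mathsf{K}^{(\gamma)}_{x \circ_{a, i} y} & \text{if } \min(y) = x_i, \\ 0 & \text{otherwise (that is, } \min(y) < x_i\text{)}. \end{cases}$$
   Context: The ground field has characteristic zero. $[\gamma] = \{1, \dots, \gamma\}$, and $[x_i, \gamma]$ is the set of integers $a$ with $x_i \leq a \leq \gamma$. $\mathsf{Dias}_\gamma$ is the nonsymmetric operad whose component of arity $n \geq 1$ is the linear span of the words of length $n$ on $\{0\} \cup [\gamma]$ having exactly one occurrence of $0$ (called the words of $\mathsf{Dias}_\gamma$), with partial compositions defined linearly by $u \circ_i v := u_1 \dots u_{i-1}\, \max(u_i, v_1) \dots \max(u_i, v_m)\, u_{i+1} \dots u_n$ for words $u$ of length $n$ and $v$ of length $m$, and with unit the word $0$. Order: for words $x, y$ of $\mathsf{Dias}_\gamma$ of the same arity $n$, $x \preccurlyeq_\gamma y$ if $x_j \leq y_j$ for all $j \in [n]$. With $\mu_\gamma$ the Möbius function of this poset, set $\mathsf{K}^{(\gamma)}_x := \sum_{x \preccurlyeq_\gamma x'} \mu_\gamma(x, x')\, x'$, the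 sum being over words $x'$ of $\mathsf{Dias}_\gamma$. The family of all $\mathsf{K}^{(\gamma)}_x$ is a basis of $\mathsf{Dias}_\gamma$, called the $\mathsf{K}$-basis. For a word $y$ of $\mathsf{Dias}_\gamma$ of length at least $2$, $\min(y)$ denotes the smallest letter of $y$ among its letters different from $0$. For words $x, y$ of $\mathsf{Dias}_\gamma$, a position $i$ with $x_i \neq 0$, and $a \in [\gamma]$, $x \circ_{a, i} y$ denotes the word $x \circ_i y$ in which the letter coming from the $0$ of $y$ is replaced by $a$ (instead of being $x_i$). *)

(* Defs.v *)
From HB Require Import structures.
From mathcomp Require Import all_boot all_order all_algebra.
From mathcomp Require Import zify.

Set Implicit Arguments.
Unset Strict Implicit.
Unset Printing Implicit Defensive.

Import Order.TTheory GRing.Theory.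

Local Open Scope ring_scope.

Section Mobius.

Context {d : Order.disp_t} {T : finPOrderType d}.
Implicit Types x y z : T.

(* The argument k bounds the recursion depth; [mobiusE] is the usual
   recursive characterization, free of this bound. *)
Fixpoint mobius_rec (k : nat) x z : int :=
  if k is k'.+1 then
    if x == z then 1
    else if (x < z)%O then - \sum_(y | (x <= y)%O && (y < z)%O) mobius_rec k' x y
    else 0
  else 0.

Definition mobius x z : int := mobius_rec #|T| x z.

Lemma mobius_rec_stable k x z :
  (#|[set y | (x <= y)%O && (y < z)%O]| < k)%N ->
  mobius_rec k.+1 x z = mobius_rec k x z.
Proof.
elim: k z => [//|k IHk] z hk.
rewrite [LHS]/= -/(mobius_rec k.+1) [RHS]/=.
case: ifP => // _; case: ifP => // _; congr (- _).
apply: eq_bigr => y /andP[xy yz]; apply: IHk.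
apply: leq_trans (proper_card _) _; last by rewrite -ltnS; exact: hk.
apply/properP; split.
  apply/subsetP => t; rewrite !inE => /andP[-> ty].
  exact: lt_trans ty yz.
by exists y; rewrite !inE ?xy ?yz // ltxx andbF.
Qed.

Lemma mobiusE x z :
  mobius x z =
    if x == z then 1
    else if (x < z)%O then - \sum_(y | (x <= y)%O && (y < z)%O) mobius x y
    else 0.
Proof.
rewrite /mobius -mobius_rec_stable //.
apply: proper_card; apply/properP; split; first exact/subsetP.
by exists z => //; rewrite inE ltxx andbF.
Qed.

End Mobius.

Section Words.

Variable gamma : nat.
Implicit Types n m : nat.

Record dias_word n := DiasWord {
  letters :> n.-tuple 'I_gamma.+1;
  _ : count_mem ord0 letters == 1%N
}.

HB.instance Definition _ n := [isSub for @letters n].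
HB.instance Definition _ n := [Finite of dias_word n by <:].

Lemma word_count n (u : dias_word n) : count_mem ord0 u = 1%N.
Proof. exact/eqP/(valP u). Qed.

Definition wle n (u v : dias_word n) : bool :=
  [forall j : 'I_n, (tnth u j <= tnth v j)%N].

Lemma wle_refl n : reflexive (@wle n).
Proof. by move=> u; apply/forallP. Qed.

Lemma wle_anti n : antisymmetric (@wle n).
Proof.
move=> u v /andP[/forallP uv /forallP vu]; apply/val_inj/eq_from_tnth => j.
by apply/val_inj/anti_leq; rewrite uv vu.
Qed.

Lemma wle_trans n : transitive (@wle n).
Proof.
move=> v u w /forallP uv /forallP vw; apply/forallP => j.
exact: leq_trans (uv j) (vw j).
Qed.

Fact dias_display : Order.disp_t. Proof. exact: Order.Disp tt tt. Qed.

HB.instance Definition _ n := Order.Le_isPOrder.Build dias_display (dias_word n)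
  (@wle_refl n) (@wle_anti n) (@wle_trans n).

Lemma wleE n (u v : dias_word n) :
  (u <= v)%O = [forall j : 'I_n, (tnth u j <= tnth v j)%N].
Proof. by []. Qed.

Definition subst_seq n m (u : n.-tuple 'I_gamma.+1) (i : 'I_n)
    (w : m.-tuple 'I_gamma.+1) : seq 'I_gamma.+1 :=
  take i u ++ w ++ drop i.+1 u.

Lemma subst_seqP n m (u : n.-tuple 'I_gamma.+1) (i : 'I_n)
    (w : m.-tuple 'I_gamma.+1) :
  size (subst_seq u i w) == (n + m).-1.
Proof.
rewrite !size_cat size_take size_drop !size_tuple ltn_ord.
by have := ltn_ord i; lia.
Qed.

Definition subst_tuple n m (u : n.-tuple 'I_gamma.+1) (i : 'I_n)
    (w : m.-tuple 'I_gamma.+1) : (n + m).-1.-tuple 'I_gamma.+1 :=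
  Tuple (subst_seqP u i w).

Definition word_comp_tuple n m (u : dias_word n) (i : 'I_n) (v : dias_word m) :=
  subst_tuple u i [tuple of map (Order.max (tnth u i)) v].

Lemma count_subst n m (u : dias_word n) (i : 'I_n) (w : m.-tuple 'I_gamma.+1) :
  (count_mem ord0 (subst_tuple u i w) + (tnth u i == ord0) =
   (count_mem ord0 w).+1)%N.
Proof.
have := word_count u; rewrite -{1}(cat_take_drop i u).
rewrite (drop_nth (tnth u i)) ?size_tuple // -tnth_nth.
by rewrite /subst_seq /= !count_cat /=; lia.
Qed.

Lemma max_eq0 (a b : 'I_gamma.+1) :
  (Order.max a b == ord0 :> 'I_gamma.+1) = (a == ord0) && (b == ord0).
Proof.
by rewrite maxEle leEord -!val_eqE /=; case: leqP; case: a b => [[|a] ?] [[|b] ?].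
Qed.

Lemma word_compP n m (u : dias_word n) (i : 'I_n) (v : dias_word m) :
  count_mem ord0 (word_comp_tuple u i v) == 1%N.
Proof.
have := count_subst u i [tuple of map (Order.max (tnth u i)) v].
rewrite -/(word_comp_tuple u i v).
have -> : count_mem ord0 [tuple of map (Order.max (tnth u i)) v] =
    (tnth u i == ord0) :> nat.
  rewrite /= count_map.
  rewrite (@eq_count _ _ (fun b => (tnth u i == ord0) && (b == ord0))).
    by case: (tnth u i == ord0); rewrite /= ?count_pred0 // (word_count v).
  by move=> b; exact: max_eq0.
by move=> h; apply/eqP; lia.
Qed.

Definition word_comp n m (u : dias_word n) (i : 'I_n) (v : dias_word m) :
    dias_word (n + m).-1 :=
  DiasWord (word_compP u i v).

Definition word_comp_repl_tuple n m (u : dias_word n) (a : 'I_gamma.+1) (i : 'I_n)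
    (v : dias_word m) :=
  subst_tuple u i
    [tuple of map (fun b => if b == ord0 then a else Order.max (tnth u i) b) v].

(* The composition u o_{a,i} v is meant for nonzero u_i and a, where it is given
   by [word_comp_replE]; otherwise the value is the dummy word u o_i v. *)
Definition word_comp_repl n m (u : dias_word n) (a : 'I_gamma.+1) (i : 'I_n)
    (v : dias_word m) : dias_word (n + m).-1 :=
  insubd (word_comp u i v) (word_comp_repl_tuple u a i v).

Lemma word_comp_replE n m (u : dias_word n) (a : 'I_gamma.+1) (i : 'I_n)
    (v : dias_word m) :
  tnth u i != ord0 -> a != ord0 ->
  letters (word_comp_repl u a i v) = word_comp_repl_tuple u a i v.
Proof.
move=> ui0 a0; rewrite -[LHS]/(val _) insubdK // -topredE /=; apply/eqP.
have := count_subst u i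
  [tuple of map (fun b => if b == ord0 then a else Order.max (tnth u i) b) v].
rewrite -/(word_comp_repl_tuple u a i v) (negPf ui0) addn0 => ->; congr _.+1.
rewrite /= count_map (@eq_count _ _ pred0) ?count_pred0 // => b /=.
case: ifP => [_|b0]; first exact: negPf.
by rewrite -[LHS]/(Order.max (tnth u i) b == ord0 :> 'I__) max_eq0 b0 andbF.
Qed.

(* The default value is the largest letter, so it does not affect the minimum as
   soon as v has a nonzero letter, i.e. as soon as m >= 2 ([min_letterP]). *)
Definition min_letter m (v : dias_word m) : 'I_gamma.+1 :=
  \big[Order.min/ord_max]_(j < m | tnth v j != ord0) tnth v j.

Lemma min_letterP m (v : dias_word m) : (2 <= m)%N ->
  (exists2 j : 'I_m, tnth v j != ord0 & min_letter v = tnth v j) /\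
  (forall j : 'I_m, tnth v j != ord0 -> (min_letter v <= tnth v j)%N).
Proof.
move=> m2; have lb j : tnth v j != ord0 -> (min_letter v <= tnth v j)%N.
  move=> vj0; rewrite -[leq _ _]/(min_letter v <= tnth v j)%O.
  exact: bigmin_le_cond.
split=> //.
have [j0 vj0] : exists j, tnth v j != ord0.
  apply/existsP; apply: contraTT m2 => /existsPn v0.
  suff /eqP : count_mem ord0 v == size v by rewrite word_count size_tuple => <-.
  by rewrite -all_count; apply/all_tnthP => j /=; apply/negPn.
have [//|e] : (exists2 j, tnth v j != ord0 & min_letter v = tnth v j) \/
    min_letter v = ord_max.
  rewrite /min_letter; elim/big_ind: _ => [|a b Ha Hb|j vj]; first by right.
  - by rewrite minElt; case: ifP.
  - by left; exists j.
exists j0 => //; apply/val_inj/anti_leq; rewrite lb // e /=.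
by rewrite -ltnS ltn_ord.
Qed.

End Words.

Section Dias.

Variables (F : fieldType) (gamma : nat).
Implicit Types n m : nat.

(* The space with basis the words of arity n: an element is the finite family
   of its coordinates. *)
Definition dias n := {ffun dias_word gamma n -> F^o}.

HB.instance Definition _ n := GRing.Lmodule.on (dias n).

Definition word_elt n (u : dias_word gamma n) : dias n := [ffun v => (v == u)%:R].

Definition dias_comp n m (p : dias n) (i : 'I_n) (q : dias m) :
    dias (n + m).-1 :=
  \sum_(u : dias_word gamma n) \sum_(v : dias_word gamma m)
    (p u * q v) *: word_elt (word_comp u i v).

Lemma dias_comp_word n m (u : dias_word gamma n) (i : 'I_n)
    (v : dias_word gamma m) :
  dias_comp (word_elt u) i (word_elt v) = word_elt (word_comp u i v).
Proof.
rewrite /dias_comp (bigD1 u) //= (bigD1 v) //= !ffunE !eqxx mulr1 scale1r.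
rewrite big1 => [|w /negPf wv]; last by rewrite !ffunE wv mulr0 scale0r.
rewrite big1 ?addr0 // => w /negPf wu; apply: big1 => t _.
by rewrite !ffunE wu mul0r scale0r.
Qed.

Definition Kelt n (x : dias_word gamma n) : dias n :=
  \sum_(x' : dias_word gamma n | (x <= x')%O) (mobius x x')%:~R *: word_elt x'.

End Dias.

(* Main.v *)
(* Words with the same position of 0 form a product of chains, so the Moebius
   function is a product over positions and K_x is a tensor product of one-letter
   factors k_a, where k_0 = [0] and k_a = [a] - [a + 1] for a > 0 (with
   [gamma + 1] = 0). Composing at i replaces each factor k_t of K_y by its image
   under max(b, -), b ranging over the letters of k_{x_i}: this image is k_t if
   0 < t and b <= t, it is 0 if 0 < t < b, and it is [b] if t = 0. So only the
   letters b <= min(y) survive, and what remains at the position of the 0 of y is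
   k_{x_i}, or [x_i] = sum_{a >= x_i} k_a, or 0, in the three respective cases. *)

Require Import Defs.
From mathcomp Require Import all_boot all_order all_algebra.
From mathcomp Require Import zify.

Set Implicit Arguments.
Unset Strict Implicit.
Unset Printing Implicit Defensive.

Import Order.TTheory GRing.Theory.

Local Open Scope ring_scope.

(** * One-letter factors: summation identities for the Moebius function of the letters *)

Section ChainMobius.

Variable R : comNzRingType.
Implicit Types a b t : nat.

(* The Moebius function of the disjoint union of {0} and the chain of positive
   integers: words are comparable only if their 0 is at the same position. *)
Definition chain_mobius a b : R :=
  (b == a)%:R - ((0 < a)%N && (b == a.+1))%:R.

Lemma chain_mobius0 b : chain_mobius 0 b = (b == 0)%N%:R.
Proof. by rewrite /chain_mobius subr0. Qed.

Lemma chain_mobius_refl a : chain_mobius a a = 1.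
Proof. by rewrite /chain_mobius eqxx ltn_eqF ?andbF ?subr0. Qed.

Lemma chain_mobius_lt a b : (b < a)%N -> chain_mobius a b = 0.
Proof.
by move=> ba; rewrite /chain_mobius !ltn_eqF ?andbF ?subr0 // ltnW.
Qed.

Lemma chain_mobius_gtS a b : (a.+1 < b)%N -> chain_mobius a b = 0.
Proof.
by move=> ba; rewrite /chain_mobius !gtn_eqF ?andbF ?subr0 // ltnW.
Qed.

Lemma chain_mobius_r0 a : (0 < a)%N -> chain_mobius a 0 = 0.
Proof. exact: chain_mobius_lt. Qed.

Lemma sum_ord_delta g (P : pred nat) t :
  \sum_(a < g.+1 | P a) ((a : nat) == t)%:R = ((t <= g)%N && P t)%:R :> R.
Proof.
rewrite -natr_sum -(big_mkord P (fun a => nat_of_bool (a == t))).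
rewrite big_mkcond; case: leqP => tg /=.
  rewrite (bigD1_seq t) ?iota_uniq ?mem_index_iota //= eqxx.
  rewrite big1 ?addn0; first by case: (P t).
  by move=> a /negPf ->; case: ifP.
rewrite big1_seq // => a /andP[_]; rewrite mem_index_iota => /andP[_ ag].
by rewrite ltn_eqF ?if_same //; lia.
Qed.

(** The terms at [s] and [s.+1] cancel, both being at most [t]: this is the defining recursion of a
    Moebius function on the interval from [s] to [t]. *)
Lemma sum_chain_mobius_le g s t : (t <= g)%N -> (0 < s < t)%N ->
  \sum_(a < g.+1 | (a <= t)%N) chain_mobius s a = 0.
Proof.
move=> tg /andP[s0 st]; rewrite /chain_mobius s0 /= sumrB.
rewrite (sum_ord_delta g (fun a => a <= t)%N).
rewrite (sum_ord_delta g (fun a => a <= t)%N).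
by rewrite st (ltnW st) (leq_trans st tg) (leq_trans (ltnW st) tg) subrr.
Qed.

(** Telescoping of [s] = sum_{a >= s} k_a, read at the coordinate [e]; it produces the sum of the
    case min(y) = x_i. *)
Lemma sum_chain_mobius_ge g s e : (e <= g)%N -> (0 < s)%N ->
  \sum_(a < g.+1 | (s <= a)%N) chain_mobius a e = (e == s)%:R.
Proof.
move=> eg s0; rewrite /chain_mobius sumrB.
rewrite (eq_bigr (fun a : 'I_g.+1 => ((a : nat) == e)%:R)); last first.
  by move=> a _; rewrite eq_sym.
rewrite (sum_ord_delta g (fun a => s <= a)%N) eg.
(* The truncated predecessor is harmless at [e = 0], since [0 < s <= a] excludes [a = 0]. *)
rewrite [X in _ - X](eq_bigr (fun a : 'I_g.+1 => ((a : nat) == e.-1)%:R)).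
  rewrite (sum_ord_delta g (fun a => s <= a)%N) (leq_trans (leq_pred e) eg) /=.
  case: (ltngtP e s) => h.
  - by rewrite (_ : (s <= e.-1)%N = false) ?subrr //; lia.
  - by rewrite (_ : (s <= e.-1)%N = true) ?subrr //; lia.
  - by rewrite (_ : (s <= e.-1)%N = false) ?subr0 //; lia.
by move=> a sa; congr _%:R; congr nat_of_bool; lia.
Qed.

(* Pushing the t-th row of the chain Moebius function forward along max(b, -):
   for t < b its two terms t and t + 1 have the same image and cancel. *)
Lemma sum_chain_mobius_max g b t e : (b <= g)%N -> (t <= g)%N ->  (e <= g)%N ->
  \sum_(a < g.+1) chain_mobius t a * (e == maxn b a)%:R =
    if t == 0%N then (e == b)%:R else (b <= t)%:R * chain_mobius t e.
Proof.
move=> bg tg eg; case: eqP => [->|/eqP t0].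
  rewrite (bigD1 ord0) //= chain_mobius0 maxn0 eqxx mul1r big1 ?addr0 // => a a0.
  by rewrite chain_mobius0 (_ : (_ == 0)%N = false) ?mul0r //; apply: negPf.
have E (f : nat -> R) s :
    \sum_(a < g.+1) ((a : nat) == s)%:R * f a = (s <= g)%:R * f s.
  rewrite -[(s <= g)%N]andbT -(sum_ord_delta g xpredT) big_distrl /=.
  by apply: eq_bigr => a _; case: eqP => [->|_] //; rewrite !mul0r.
rewrite /chain_mobius lt0n t0 /=.
under eq_bigr do rewrite mulrBl.
rewrite sumrB (E (fun a => (e == maxn b a)%:R)) (E (fun a => (e == maxn b a)%:R)).
rewrite tg /= mul1r; case: (leqP b t) => bt.
  rewrite /= mul1r (maxn_idPr (leqW bt)); congr (_ - _).
  (* For [t = g] the letter [t.+1] is out of range on the left; on the right its term vanishes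
     because [e <= g]. *)
  by rewrite -natrM mulnb; congr _%:R; congr nat_of_bool; lia.
by rewrite (leq_trans bt bg) /= mul1r (maxn_idPl bt) mul0r subrr.
Qed.

Lemma sum_chain_mobius_max_ord g (b t e : 'I_g.+1) :
  \sum_(a : 'I_g.+1) chain_mobius t a * (e == Order.max b a)%:R =
    if t == ord0 then (e == b)%:R else (b <= t)%N%:R * chain_mobius t e.
Proof.
have := @sum_chain_mobius_max g b t e (ltn_ord b) (ltn_ord t) (ltn_ord e).
rewrite -[(t : nat) == 0%N]/(t == ord0) => <-; apply: eq_bigr => a _.
congr (_ * _%:R); rewrite -val_eqE /= maxEle leEord; congr (nat_of_bool (_ == _)).
by rewrite (fun_if val); case: leqP.
Qed.

End ChainMobius.

Lemma intr_chain_mobius (R : comNzRingType) a b :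
  (chain_mobius int a b)%:~R = chain_mobius R a b.
Proof. by rewrite /chain_mobius rmorphB /= !rmorph_nat. Qed.

(** * Sums and products over tuples *)

Lemma sum_tuple_prod (R : comPzSemiRingType) (T : finType) n
    (g : 'I_n -> T -> R) :
  \sum_(t : n.-tuple T) \prod_(j < n) g j (tnth t j) = \prod_(j < n) \sum_a g j a.
Proof.
rewrite bigA_distr_bigA /=.
rewrite (reindex (fun f : {ffun 'I_n -> T} => [tuple f j | j < n])).
  by apply: eq_bigr => f _; apply: eq_bigr => j _; rewrite tnth_mktuple.
exists (fun t : n.-tuple T => [ffun j => tnth t j]) => [f _|t _].
  by apply/ffunP => j; rewrite ffunE tnth_mktuple.
by apply/eq_from_tnth => j; rewrite tnth_mktuple ffunE.
Qed.

Lemma natr_eq_tuple (R : comPzSemiRingType) (T : eqType) n (s t : n.-tuple T) :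
  (s == t)%:R = \prod_(j < n) (tnth s j == tnth t j)%:R :> R.
Proof.
case: eqP => [->|st]; first by rewrite big1 // => j _; rewrite eqxx.
have [j stj] : exists j, tnth s j != tnth t j.
  apply/existsP; apply: contra_notT st => /existsPn st.
  by apply/eq_from_tnth => j; apply/eqP/negPn.
by rewrite (bigD1 j) //= (negPf stj) mul0r.
Qed.

Lemma prod_zip (R : comPzSemiRingType) (T : Type) (x0 : T) (f : T -> T -> R)
    (s t : seq T) : size s = size t ->
  \prod_(p <- zip s t) f p.1 p.2 =
  \prod_(0 <= l < size s) f (nth x0 s l) (nth x0 t l).
Proof.
move=> st; rewrite (big_nth (x0, x0)) size_zip st minnn; apply: eq_bigr => l _.
by rewrite nth_zip.
Qed.


(** * Splitting tuples and products along a substitution *)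

Section Subst.

Variables (gamma n m : nat).
Implicit Types (u w : n.-tuple 'I_gamma.+1) (v : m.-tuple 'I_gamma.+1).

Lemma subst_tuple_surj (i : 'I_n) (w : (n + m).-1.-tuple 'I_gamma.+1) :
  exists u v, w = subst_tuple u i v.
Proof.
have i_n := ltn_ord i.
have sw := size_tuple w.
(* The letter [ord0] at position [i] is a filler, discarded by [subst_tuple]. *)
have su : size (take i w ++ ord0 :: drop (i + m) w) == n.
  by rewrite size_cat /= size_takel ?size_drop sw; lia.
have sv : size (take m (drop i w)) == m.
  by rewrite size_takel ?size_drop ?sw; lia.
exists (Tuple su), (Tuple sv); apply/val_inj; rewrite /= /subst_seq /=.
have si : size (take i w) = i by rewrite size_takel ?sw; lia.
rewrite take_cat drop_cat si ltnn subnn take0 cats0 ltnNge leqnSn /=.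
rewrite subSn // subnn /= drop0 (addnC i m) -drop_drop.
by rewrite cat_take_drop cat_take_drop.
Qed.



(** The function [f] is kept general to serve both for [chain_mobius] and for the equality test of
    letters. *)
Lemma prod_subst_tuple (R : comPzSemiRingType)
    (f : 'I_gamma.+1 -> 'I_gamma.+1 -> R) u u' (i : 'I_n) v v' :
  \prod_(l < (n + m).-1) f (tnth (subst_tuple u i v) l)
                           (tnth (subst_tuple u' i v') l) =
  (\prod_(j < n | j != i) f (tnth u j) (tnth u' j)) *
  \prod_(k < m) f (tnth v k) (tnth v' k).
Proof.
have sz (s : n.-tuple 'I_gamma.+1) : size (take i s) = i.
  by rewrite size_takel // size_tuple ltnW.
have dsz (s : n.-tuple 'I_gamma.+1) : size (drop i.+1 s) = (n - i.+1)%N.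
  by rewrite size_drop size_tuple.
pose a : 'I_gamma.+1 := ord0.
have prodE k (s t : k.-tuple 'I_gamma.+1) (P : pred nat) :
    \prod_(l < k | P l) f (tnth s l) (tnth t l) =
    \prod_(0 <= l < k | P l) f (nth a s l) (nth a t l).
  by rewrite big_mkord; apply: eq_bigr => l _; rewrite !(tnth_nth a).
have split_prod (s t : n.-tuple 'I_gamma.+1) :
    \prod_(j < n | j != i) f (tnth s j) (tnth t j) =
    (\prod_(p <- zip (take i s) (take i t)) f p.1 p.2) *
    \prod_(p <- zip (drop i.+1 s) (drop i.+1 t)) f p.1 p.2.
  rewrite (prodE _ _ _ (fun l => l != i)) !(prod_zip a) ?sz ?dsz //.
  rewrite (big_cat_nat (n := i)) ?(ltnW (ltn_ord i)) //=; congr (_ * _).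
    rewrite big_nat_cond [RHS]big_nat; apply: eq_big => l.
      by case: ltngtP.
    by move=> /andP[/andP[_ li] _]; rewrite !nth_take.
  rewrite big_mkcond big_ltn //= eqxx mul1r -big_mkcond -[i.+1 in LHS]add0n big_addn.
  rewrite big_nat_cond [RHS]big_nat; apply: eq_big => l.
    by rewrite -(eqn_add2r 0); lia.
  by move=> _; rewrite !nth_drop addnC.
have zipE k (s t : k.-tuple 'I_gamma.+1) :
    \prod_(l < k) f (tnth s l) (tnth t l) = \prod_(p <- zip s t) f p.1 p.2.
  by rewrite (prodE _ _ _ xpredT) (prod_zip a) ?size_tuple.
rewrite !zipE split_prod /= /subst_seq !zip_cat ?sz ?size_tuple //.
by rewrite !big_cat /= mulrCA mulrC -!mulrA; congr (_ * _); rewrite mulrC.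
Qed.

End Subst.


(** * The Moebius function of the poset of words *)

Section Words.

Variable gamma : nat.

Lemma word_zero n (u : dias_word gamma n) : exists j, tnth u j = ord0.
Proof.
have: ord0 \in letters u by rewrite -has_pred1 has_count word_count.
by move=> /tnthP[j ->]; exists j.
Qed.

Lemma word_zero_uniq n (u : dias_word gamma n) j k :
  tnth u j = ord0 -> tnth u k = ord0 -> j = k.
Proof.
move=> uj uk; apply/eqP/negPn/negP => jk; have := word_count u.
rewrite -sum1_count big_tuple (bigD1 j) ?uj //= (bigD1 k) ?uk //= eq_sym //.
Qed.

(* The product vanishes unless u has its zeros exactly where x has, hence on all
   tuples that are not words. *)
Lemma sum_word_chain_mobius (R : comNzRingType) n (x : dias_word gamma n)
    (phi : n.-tuple 'I_gamma.+1 -> R) :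
  \sum_(u : dias_word gamma n)
    (\prod_(j < n) chain_mobius R (tnth x j) (tnth u j)) * phi u =
  \sum_(u : n.-tuple 'I_gamma.+1)
    (\prod_(j < n) chain_mobius R (tnth x j) (tnth u j)) * phi u.
Proof.
rewrite [RHS](bigID (fun u : n.-tuple 'I_gamma.+1 => count_mem ord0 u == 1%N)) /=.
rewrite [X in _ + X]big1 ?addr0; last first.
  move=> u /eqP u1; rewrite (_ : \prod_(_ < _) _ = 0) ?mul0r //.
  have [j xj] : exists j, (tnth x j == ord0) != (tnth u j == ord0).
    apply/existsP; apply: contra_notT u1 => /existsPn xu.
    rewrite -(word_count x) -!sum1_count !big_tuple; apply: eq_bigl => j.
    by apply/esym; move: (xu j); rewrite negbK => /eqP.
  rewrite (bigD1 j) //=; move: xj; rewrite -!val_eqE /= => xj.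
  case: (posnP (tnth x j)) xj => [->|x0].
    rewrite chain_mobius0; case: (nat_of_ord (tnth u j) =P 0%N) => // _.
    by rewrite mul0r.
  case: (nat_of_ord (tnth u j) =P 0%N) => [->|//] _.
  by rewrite chain_mobius_r0 ?mul0r.
rewrite [RHS](reindex_omap (@letters gamma n) insub) => [|u u1]; last first.
  by rewrite insubT.
by apply: eq_bigl => u; rewrite word_count eqxx -[letters u]/(val u) valK eqxx.
Qed.

(** Induction on the number of words below [z]. For [x < z] it suffices that the products sum to 0
    over the interval; this sum factors over positions, and the factor at a position where [x] and
    [z] differ is 0 by [sum_chain_mobius_le]. *)
Lemma mobius_word n (x z : dias_word gamma n) :
  mobius x z = \prod_(j < n) chain_mobius int (tnth x j) (tnth z j).
Proof.
have [k] := ubnP #|[set y | (y < z)%O]|; elim: k z => [//|k IHk] z hk.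
rewrite mobiusE; case: eqP => [<-|/eqP xz].
  by rewrite big1 // => j _; rewrite chain_mobius_refl.
have not_le u : ~~ (x <= u)%O ->
    \prod_(j < n) chain_mobius int (tnth x j) (tnth u j) = 0.
  rewrite wleE => /forallPn[j]; rewrite -ltnNge => xuj.
  by rewrite (bigD1 j) //= chain_mobius_lt ?mul0r.
rewrite lt_neqAle xz /=; case: ifP => [lexz|/negbT/not_le //].
have [j xzj] : exists j, tnth x j != tnth z j.
  apply/existsP; apply: contraNT xz => /existsPn xz.
  by apply/eqP/val_inj/eq_from_tnth => j; apply/eqP/negPn.
have lejx l : (tnth x l <= tnth z l)%N by move: lexz; rewrite wleE => /forallP.
(* Since [x <= z], the 0 of [z] lies where the 0 of [x] does, and there the two words agree. *)
have xj0 : (0 < tnth x j)%N.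
  rewrite lt0n; apply: contra xzj => /eqP xj0.
  have [l zl0] := word_zero z.
  have xl0 : tnth x l = ord0.
    by apply/val_inj/eqP; have := lejx l; rewrite zl0 leqn0.
  have xj : tnth x j = ord0 by exact: val_inj.
  by rewrite xj -(word_zero_uniq xl0 xj) zl0.
apply/esym/eqP; rewrite -subr_eq0 opprK; apply/eqP.
have -> : \sum_(y | (x <= y)%O && (y < z)%O) mobius x y =
    \sum_(y | (y <= z)%O && (y != z))
      \prod_(j < n) chain_mobius int (tnth x j) (tnth y j).
  rewrite [RHS](bigID (fun y => x <= y)%O) /= [X in _ + X]big1 ?addr0; last first.
    by move=> y /andP[_ /not_le].
  apply: eq_big => [y|y /andP[_ yz]].
    by rewrite lt_neqAle andbC [(_ != _) && _]andbC.
  apply: IHk; apply: leq_trans (proper_card _) _; last first.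
    by rewrite -ltnS; exact: hk.
  apply/properP; split; last by exists y; rewrite !inE ?yz ?ltxx.
  by apply/subsetP => t; rewrite !inE => ty; exact: lt_trans ty yz.
(* The term at [z] completes the sum; the bound [u <= z] becomes an indicator, which allows passing
   from words to all tuples. *)
rewrite -(bigD1 z) //= big_mkcond /=.
under eq_bigr => u _ do rewrite -mulrb -mulr_natr wleE.
rewrite (sum_word_chain_mobius x
  (fun u => [forall l : 'I_n, (tnth u l <= tnth z l)%N]%:R)).
have E (u : n.-tuple 'I_gamma.+1) :
    [forall l : 'I_n, (tnth u l <= tnth z l)%N]%:R =
    \prod_(l < n) (tnth u l <= tnth z l)%N%:R :> int.
  case: forallP => [uz|/forallP/forallPn[l ul]].
    by rewrite big1 // => l _; rewrite uz.
  by rewrite (bigD1 l) //= (negPf ul) mul0r.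
under eq_bigr => u _ do rewrite E -big_split /=.
rewrite (sum_tuple_prod (fun l (a : 'I_gamma.+1) =>
  chain_mobius int (tnth x l) a * (a <= tnth z l)%N%:R)).
rewrite (bigD1 j) //= (_ : \sum_a _ = 0) ?mul0r //.
rewrite -[RHS](@sum_chain_mobius_le int gamma (tnth x j) (tnth z j)).
- by rewrite [RHS]big_mkcond; apply: eq_bigr => a _; rewrite mulr_natr mulrb.
- by rewrite -ltnS.
- by rewrite xj0 ltn_neqAle xzj lejx.
Qed.

End Words.

(** * Coordinates of the K-basis and of its compositions *)

Section Dias.

Variables (F : fieldType) (gamma : nat).

(** The Moebius function vanishes unless [x <= w], so the product gives the coordinate at every word
    [w]. *)
Lemma Kelt_coef n (x w : dias_word gamma n) :
  Kelt F x w = \prod_(j < n) chain_mobius F (tnth x j) (tnth w j).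
Proof.
rewrite /Kelt sum_ffunE.
transitivity ((mobius x w)%:~R : F); last first.
  rewrite mobius_word rmorph_prod; apply: eq_bigr => j _.
  exact: intr_chain_mobius.
case: (boolP (x <= w)%O) => xw.
  rewrite (bigD1 w) //= !ffunE eqxx big1 => [|v /andP[_ vw]].
    by rewrite addr0 -[_ *: _]/(_ * _) mulr1.
  by rewrite !ffunE eq_sym (negPf vw) scaler0.
rewrite big1 => [|v xv]; first rewrite mobiusE.
  case: eqP xw => [->|_ xw]; first by rewrite lexx.
  by rewrite lt_neqAle (negPf xw) andbF.
by rewrite !ffunE (_ : w == v = false) ?scaler0 //; apply: contraNF xw => /eqP ->.
Qed.

(* The i-th letter of wx is irrelevant: every w has such a decomposition by
   [subst_tuple_surj]. The sum over b is over the i-th letter of the words that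
   occur in K_x. *)
Lemma dias_comp_Kelt_coef n m (x : dias_word gamma n) (y : dias_word gamma m)
    (i : 'I_n) (w : dias_word gamma (n + m).-1) wx wy :
  letters w = subst_tuple wx i wy ->
  dias_comp (Kelt F x) i (Kelt F y) w =
    (\prod_(j < n | j != i) chain_mobius F (tnth x j) (tnth wx j)) *
    \sum_(b : 'I_gamma.+1) chain_mobius F (tnth x i) b *
      \prod_(k < m) if tnth y k == ord0 then (tnth wy k == b)%:R
         else (b <= tnth y k)%N%:R * chain_mobius F (tnth y k) (tnth wy k).
Proof.
move=> wE; rewrite /dias_comp sum_ffunE.
(* [phi] and [psi] test agreement with [w] on the inserted block and on the other positions; [blk b]
   is the contribution of the block when the outer letter at [i] is [b]. *)
pose phi b (v : m.-tuple 'I_gamma.+1) : F :=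
  \prod_(k < m) (tnth wy k == Order.max b (tnth v k))%:R.
pose psi (u : n.-tuple 'I_gamma.+1) : F :=
  \prod_(j < n | j != i) (tnth wx j == tnth u j)%:R.
pose blk b := \sum_(v : m.-tuple 'I_gamma.+1)
   (\prod_(k < m) chain_mobius F (tnth y k) (tnth v k)) * phi b v.
transitivity (\sum_(u : dias_word gamma n)
    (\prod_(j < n) chain_mobius F (tnth x j) (tnth u j)) *
      (psi u * blk (tnth u i))).
  apply: eq_bigr => u _; rewrite sum_ffunE mulrA.
  rewrite /blk -(sum_word_chain_mobius y (phi (tnth u i))) mulr_sumr.
  apply: eq_bigr => v _; rewrite !ffunE !Kelt_coef -[_ *: _]/(_ * _).
  rewrite -val_eqE /= wE natr_eq_tuple.
  rewrite (@prod_subst_tuple _ _ _ F (fun a b => (a == b)%:R)) -/(psi u).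
  rewrite -!mulrA; congr (_ * _); rewrite mulrCA; congr (_ * (_ * _)).
  by apply: eq_bigr => k _; rewrite tnth_map.
rewrite (sum_word_chain_mobius x (fun u => psi u * blk (tnth u i))).
(* The block depends on [u] only through its letter at [i], so the summand is a product over the
   positions of [u]. *)
transitivity (\sum_(u : n.-tuple 'I_gamma.+1) \prod_(j < n)
   (chain_mobius F (tnth x j) (tnth u j) *
     if j == i then blk (tnth u j) else (tnth wx j == tnth u j)%:R)).
  apply: eq_bigr => u _; rewrite big_split; congr (_ * _).
  rewrite [RHS](bigD1 i) //= eqxx mulrC; congr (_ * _).
  by apply: eq_bigr => j /negPf ->.
rewrite (sum_tuple_prod (fun j (a : 'I_gamma.+1) => chain_mobius F (tnth x j) a *
     if j == i then blk a else (tnth wx j == a)%:R)).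
rewrite (bigD1 i) //= mulrC; congr (_ * _).
  apply: eq_bigr => j /negPf ji; rewrite (bigD1 (tnth wx j)) //= ji eqxx mulr1.
  by rewrite big1 ?addr0 // => a /negPf aw; rewrite eq_sym aw mulr0.
apply: eq_bigr => b _; rewrite eqxx; congr (_ * _).
transitivity (\sum_(v : m.-tuple 'I_gamma.+1) \prod_(k < m)
   (chain_mobius F (tnth y k) (tnth v k) *
    (tnth wy k == Order.max b (tnth v k))%:R)).
  by apply: eq_bigr => v _; rewrite big_split.
rewrite (sum_tuple_prod (fun k (a : 'I_gamma.+1) => chain_mobius F (tnth y k) a *
   (tnth wy k == Order.max b a)%:R)).
by apply: eq_bigr => k _; exact: sum_chain_mobius_max_ord.
Qed.

(** The conditions [b <= tnth y k] at the nonzero letters of [y] hold together exactly when b <=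
    min(y). *)
Lemma prod_block m (y : dias_word gamma m) (wy : m.-tuple 'I_gamma.+1) k0
    (b : 'I_gamma.+1) : (2 <= m)%N -> tnth y k0 = ord0 ->
  \prod_(k < m) (if tnth y k == ord0 then (tnth wy k == b)%:R
         else (b <= tnth y k)%N%:R * chain_mobius F (tnth y k) (tnth wy k)) =
  (tnth wy k0 == b)%:R * (b <= min_letter y)%N%:R *
  \prod_(k < m | k != k0) chain_mobius F (tnth y k) (tnth wy k).
Proof.
move=> m2 yk0; have [[k1 yk1 minE] lb] := min_letterP y m2.
have y_neq0 k : (k != k0) = (tnth y k != ord0).
  apply/idP/idP => [|]; last by apply: contraNneq => ->; rewrite yk0.
  by apply: contraNneq => yk; rewrite (word_zero_uniq yk yk0).
rewrite (bigD1 k0) //= yk0 eqxx -mulrA; congr (_ * _).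
transitivity (\prod_(k < m | k != k0) ((b <= tnth y k)%N%:R *
    chain_mobius F (tnth y k) (tnth wy k))).
  by apply: eq_bigr => k; rewrite y_neq0 => /negPf ->.
rewrite big_split; congr (_ * _); case: leqP => [bmin|minb].
  by rewrite big1 // => k; rewrite y_neq0 => /lb/(leq_trans bmin) ->.
by rewrite (bigD1 k1) ?y_neq0 //= -minE leqNgt minb mul0r.
Qed.

(** Serves both nonzero cases of the formula: when x_i <= min(y), the inserted block [t] differs
    from [y] at most at its 0, where it carries x_i or a. *)
Lemma Kelt_subst_coef n m (x : n.-tuple 'I_gamma.+1) (y : dias_word gamma m)
    (i : 'I_n) (w z : dias_word gamma (n + m).-1) (t : m.-tuple 'I_gamma.+1)
    wx wy k0 :
  letters w = subst_tuple wx i wy -> letters z = subst_tuple x i t ->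
  (forall k, k != k0 -> tnth t k = tnth y k) ->
  Kelt F z w =
    (\prod_(j < n | j != i) chain_mobius F (tnth x j) (tnth wx j)) *
    (chain_mobius F (tnth t k0) (tnth wy k0) *
     \prod_(k < m | k != k0) chain_mobius F (tnth y k) (tnth wy k)).
Proof.
move=> wE zE tE; rewrite Kelt_coef wE zE.
rewrite (prod_subst_tuple (fun a b : 'I_gamma.+1 => chain_mobius F a b)).
rewrite [X in _ * X](bigD1 k0) //=; congr (_ * (_ * _)).
by apply: eq_bigr => k /tE ->.
Qed.

End Dias.

(** * Comparison of coordinates in the three cases *)

Theorem theorem2p3p7 (F : fieldType) (charF0 : [pchar F] =i pred0) (gamma n m : nat)
    (hn : (2 <= n)%N) (hm : (2 <= m)%N)
    (x : dias_word gamma n) (y : dias_word gamma m) (i : 'I_n) :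
  dias_comp (Kelt F x) i (Kelt F y) =
    if (tnth x i < min_letter y)%N then Kelt F (word_comp x i y)
    else if min_letter y == tnth x i then
      \sum_(a : 'I_gamma.+1 | (tnth x i <= a)%N) Kelt F (word_comp_repl x a i y)
    else 0.
Proof.
apply/ffunP => w; have [wx [wy wE]] := subst_tuple_surj i (letters w).
have [k0 yk0] := word_zero y; have [[k1 yk1 minE] lb] := min_letterP y hm.
have min_gt0 : (0 < min_letter y)%N by rewrite minE lt0n.
have y_neq0 k : k != k0 -> tnth y k != ord0.
  by apply: contraNneq => yk; rewrite (word_zero_uniq yk yk0).
rewrite (dias_comp_Kelt_coef F x y wE).
(* In the sum over [b], the factor at the 0 of [y] selects [b = tnth wy k0]. *)
rewrite [X in _ * X](_ : _ =
    chain_mobius F (tnth x i) (tnth wy k0) * (tnth wy k0 <= min_letter y)%N%:R *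
    \prod_(k < m | k != k0) chain_mobius F (tnth y k) (tnth wy k)); last first.
  under eq_bigr => b _ do rewrite (prod_block F wy b hm yk0) mulrA.
  rewrite -mulr_suml; congr (_ * _).
  rewrite (bigD1 (tnth wy k0)) //= eqxx mul1r big1 ?addr0 // => b /negPf wb.
  by rewrite eq_sym wb mul0r mulr0.
case: ltnP => [xi_lt|min_le].
  rewrite (@Kelt_subst_coef F gamma n m x y i w (word_comp x i y)
    [tuple of map (Order.max (tnth x i)) y] wx wy k0 wE erefl)
    => [|k /y_neq0 /lb yk].
    congr (_ * (_ * _)); rewrite tnth_map yk0 max_l ?leEord //.
    (* k_{x_i} is supported on letters at most x_i + 1 <= min(y), so the indicator changes
       nothing. *)
    case: leqP => [_|lt_w]; first by rewrite mulr1.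
    by rewrite chain_mobius_gtS ?mul0r // (leq_ltn_trans xi_lt).
  by rewrite tnth_map max_r // leEord (leq_trans (ltnW xi_lt)).
case: eqP => [min_eq|/eqP min_neq]; last first.
  (* A nonzero coordinate would need a letter at [k0] that is at least x_i and at most min(y) <
     x_i. *)
  rewrite ffunE; case: leqP => [wk0|_]; last by rewrite mulr0 mul0r mulr0.
  rewrite chain_mobius_lt ?mul0r ?mulr0 //; apply: leq_ltn_trans wk0 _.
  by rewrite ltn_neqAle min_le andbT.
have xi0 : (0 < tnth x i)%N by rewrite -min_eq.
rewrite sum_ffunE.
transitivity (\sum_(a : 'I_gamma.+1 | (tnth x i <= a)%N)
    (\prod_(j < n | j != i) chain_mobius F (tnth x j) (tnth wx j)) *
    (chain_mobius F a (tnth wy k0) *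
     \prod_(k < m | k != k0) chain_mobius F (tnth y k) (tnth wy k))).
  (* With min(y) = x_i the indicator cuts k_{x_i} down to [x_i], the sum of the k_a for a >= x_i. *)
  rewrite -mulr_sumr -mulr_suml; congr (_ * (_ * _)).
  rewrite (@sum_chain_mobius_ge F gamma _ _ (ltn_ord (tnth wy k0)) xi0) min_eq.
  case: (ltngtP (tnth wy k0) (tnth x i)) => wk0.
  - by rewrite chain_mobius_lt // mul0r.
  - by rewrite mulr0.
  - by rewrite wk0 chain_mobius_refl mulr1.
apply: eq_bigr => a xia.
(* Here a >= x_i = min(y) > 0, so [word_comp_repl] does not take its dummy value. *)
have ra : letters (word_comp_repl x a i y) = word_comp_repl_tuple x a i y.
  by apply: word_comp_replE; rewrite -lt0n // (leq_trans xi0).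
rewrite (Kelt_subst_coef F wE ra (k0 := k0) (y := y)) => [|k k_k0].
  by rewrite tnth_map yk0 eqxx.
rewrite tnth_map (negPf (y_neq0 k k_k0)) max_r // leEord -min_eq.
exact/lb/y_neq0.
Qed.
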